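(* Let $B$ be a unital $\mathbb K$-algebra, let $F,G\in G_B^{\mathrm{inv}}$, and put $$H_1:=S^l\big(G\rhd_r S^l(F)\big),\qquad H_2:=S^r\big(F\rhd_l S^r(G)\big).$$ Then $$F\circledast G=G\star_l H_1,\qquad F\circledast G=F\star_r H_2,\qquad F\circledast G=H_1\cdot H_2,$$ and $$H_1=H_2\rhd_r F,\qquad H_2=H_1\rhd_l G .$$ Moreover, $$(GI)\circ(IH_1)=(IF)\circ(H_2I),$$ which can be reformulated as: for all $L\in G_B^{\mathrm{inv}}$, $$H_1\rhd_l(G\rhd_r L)=H_2\rhd_r(F\rhd_l L).$$
   Context: $\mathbb K$ is a field of characteristic zero. For a unital $\mathbb K$-algebra $B$, $\mathrm{Mult}[[B]]$ is the set of sequences $f=(f_n)_{n\ge0}$ of $\mathbb K$-multilinear maps $f_n:B^{\otimes n}\to B$ (with $B^{\otimes 0}=\mathbb K$, so $f_0$ is identified with an element of $B$). Product: $(f\cdot g)_n(x_1,\dots,x_n)=\sum_{k=0}^n f_k(x_1,\dots,x_k)\,g_{n-k}(x_{k+1},\dots,x_n)$, also written $fg$, with unit $1=(\delta_{n,0}1)_n$. Composition, when $g_0=0$: $(f\circ g)_n(x_1,\dots,x_n)=\sum_{l\ge0}\sum_{k_1+\cdots+k_l=n,\,k_i\ge1}f_l\big(g_{k_1}(x_1,\dots,x_{k_1}),\dots,g_{k_l}(x_{n-k_l+1},\dots,x_n)\big)$, with unit $I=(\delta_{n,1}\mathrm{Id})_n$. Composition takes precedence over multiplication: $f\cdot g\circ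 h\cdot k=f\cdot(g\circ h)\cdot k$. $G_B^{\mathrm{inv}}=\{f: f_0\in B^\times\}$ is a group for $\cdot$, with inverse $f^{-1}$; $G_B^{\mathrm{dif}}=\{f: f_0=0,\ f_1\in \mathrm{GL}(B)\}$ is a group for $\circ$, with inverse $f^{\circ-1}$. For $F,G\in G_B^{\mathrm{inv}}$: $F\rhd_l G:=G\circ(IF)$, $F\rhd_r G:=G\circ(FI)$; $F\star_l G:=G\cdot F\circ(IG)$, $F\star_r G:=F\circ(GI)\cdot G$, $F\bullet G:=G\cdot F\circ(G^{-1}IG)$; $S^l(F):=F^{-1}\circ(IF)^{\circ-1}$, $S^r(F):=F^{-1}\circ(FI)^{\circ-1}$; the boxed convolution is $F\circledast G:=S^l\big(S^l(F)\bullet S^l(G)\big)$. *)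

(* Defs.v *)
From mathcomp Require Import all_boot all_order all_algebra.
From mathcomp Require Import boolp classical_sets.

Set Implicit Arguments.
Unset Strict Implicit.
Unset Printing Implicit Defensive.

Import GRing.Theory.
Local Open Scope ring_scope.

(* A sequence (f_n)_n of maps f_n : B^n -> B is encoded as one function
   f : seq B -> B, with f_n its restriction to sequences of size n; in
   particular f_0 is f [::].  Membership in Mult[[B]] is [multilinear f]. *)

Section Mult.
Context {K : fieldType} {B : algType K}.
Implicit Types f g F G : seq B -> B.

Definition multilinear f : Prop :=
  forall s1 s2 : seq B, linear (fun x : B => f (s1 ++ x :: s2)).

Definition mone : seq B -> B := fun s => if s is [::] then 1 else 0.

Definition mid : seq B -> B := fun s => if s is [:: x] then x else 0.

Definition mmul f g : seq B -> B := fun s =>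
  \sum_(k < (size s).+1) f (take k s) * g (drop k s).

(* Sum over l and over the compositions (k_1, ..., k_l) of n = size s into
   positive parts; both l and the k_i are at most n. The definition is used
   only when g [::] = 0. *)
Definition mcomp f g : seq B -> B := fun s =>
  \sum_(l < (size s).+1)
    \sum_(k : l.-tuple 'I_(size s).+1 |
          all (fun i : 'I_(size s).+1 => (0 < i)%N) k
          && (sumn (map val k) == size s))
      f (map g (reshape (map val k) s)).

Definition Ginv f : Prop :=
  multilinear f /\ exists b : B, b * f [::] = 1 /\ f [::] * b = 1.

Definition Gdif f : Prop :=
  [/\ multilinear f, f [::] = 0 & bijective (fun x : B => f [:: x])].

(* Group inverses: [xget] returns the element of the set, with a junk default
   when there is none, which does not occur for f in Ginv (resp. Gdif). *)
Definition minv f : seq B -> B :=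
  xget mone [set g | [/\ Ginv g, mmul f g = mone & mmul g f = mone]]%classic.

Definition mcinv f : seq B -> B :=
  xget mid [set g | [/\ Gdif g, mcomp f g = mid & mcomp g f = mid]]%classic.

End Mult.

Declare Scope mult_scope.
Delimit Scope mult_scope with mult.
Notation "f ** g" := (mmul f g) (at level 40, left associativity) : mult_scope.
Notation "f \oc g" := (mcomp f g) (at level 35, no associativity) : mult_scope.

Section Operations.
Context {K : fieldType} {B : algType K}.
Implicit Types F G : seq B -> B.
Local Open Scope mult_scope.

Definition rhd_l F G := G \oc (mid ** F).
Definition rhd_r F G := G \oc (F ** mid).
Definition star_l F G := G ** F \oc (mid ** G).
Definition star_r F G := F \oc (G ** mid) ** G.
Definition bullet F G := G ** F \oc (minv G ** mid ** G).
Definition S_l F := minv F \oc mcinv (mid ** F).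
Definition S_r F := minv F \oc mcinv (F ** mid).
Definition boxconv F G := S_l (bullet (S_l F) (S_l G)).

End Operations.

(* Main.v *)
Require Import Defs.
From mathcomp Require Import all_boot all_order all_algebra.
From mathcomp Require Import boolp classical_sets.

Set Implicit Arguments.
Unset Strict Implicit.
Unset Printing Implicit Defensive.

Import GRing.Theory.
Local Open Scope ring_scope.
Local Open Scope mult_scope.

(** Write l_X = I X and r_X = X I.  Composition is associative and right
    distributive over the product, and I o h = h.  Hence
      S^l(X) = X^{-1} o l_X^{o-1}   satisfies   l_{S^l(X)} = l_X^{o-1},
    and likewise r_{S^r(X)} = r_X^{o-1}.  As X is recovered from l_X by
    evaluating at a first argument 1 (and from r_X at a last argument 1), these
    identities characterize S^l and S^r.

    Put A = S^l(F), so that H1 = S^l(A o r_G), and Y = G o l_{H1}.  Distributivity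
    gives l_A o r_G = G l_{A o r_G}, and composing with
    l_{H1} = l_{A o r_G}^{o-1} yields l_A o r_G o l_{H1} = r_Y, that is
      r_G o l_{H1} = l_F o r_Y                        (lemma [exchange]).
    Expanding both sides by distributivity gives Y I H1 = Y I (F o r_Y), so
    H1 = F o r_Y ([H1_rhd_r]).  With C = S^r(G), composing the exchange identity with
    r_C on the left gives
      (r_{C o l_F} o r_Y) (F o r_Y) = r_C o l_F o r_Y = l_{H1} = I H1;
    cancelling H1 = F o r_Y shows that r_Y is the inverse of r_{C o l_F}, so
    Y = H2 ([H2_rhd_l]).  Finally l_{H1 Y} = l_{H1} (G o l_{H1}) = l_G o l_{H1}, and for
    D = S^l(G) one finds l_{A . D} o l_G = l_{A o r_G} (where . is the bullet
    product), whence l_{A . D} o l_{H1 Y} = I: this is S^l(A . D) = H1 Y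
    ([boxconv_mmul]).  The other identities are rewritings of these three.

    The group laws themselves rest on one recursion: a composite f o g evaluated at
    a nonempty word is the sum, over the first block a of the word, of the
    composite of f(g(a), ...) with g at the rest of the word ([mcomp_cons]).
    Associativity and distributivity both follow from it by coassociativity of
    deconcatenation of words.  Inverses are built degree by degree as limits of
    the iterations g + f_0^{-1} (1 - f g) and g + f_1^{-1} (I - f o g), which
    visibly preserve multilinearity. *)

(** * Deconcatenation of words *)

Section Deconcatenation.
Context {T : Type} {V : zmodType}.
Implicit Types (phi psi : seq T -> seq T -> V) (s : seq T).

Definition cutsum phi s : V := \sum_(k < (size s).+1) phi (take k s) (drop k s).

Lemma cutsum0 phi : cutsum phi [::] = phi [::] [::].
Proof. by rewrite /cutsum big_ord1. Qed.

Lemma cutsum_cons phi x s :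
  cutsum phi (x :: s) = phi [::] (x :: s) + cutsum (fun a c => phi (x :: a) c) s.
Proof. by rewrite /cutsum big_ord_recl. Qed.

Lemma cutsum_rcut phi s :
  cutsum phi s = \sum_(k < size s) phi (take k s) (drop k s) + phi s [::].
Proof. by rewrite /cutsum big_ord_recr /= take_size drop_size. Qed.

Lemma eq_cutsum phi psi s :
  (forall a c, a ++ c = s -> phi a c = psi a c) -> cutsum phi s = cutsum psi s.
Proof. by move=> e; apply: eq_bigr => k _; apply: e; rewrite cat_take_drop. Qed.

Lemma cutsumD phi psi s :
  cutsum (fun a c => phi a c + psi a c) s = cutsum phi s + cutsum psi s.
Proof. exact: big_split. Qed.

(** Cutting a word in three does not depend on which cut is made first. *)
Lemma cutsum_coassoc (phi : seq T -> seq T -> seq T -> V) s :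
  cutsum (fun w v => cutsum (fun a b => phi a b v) w) s =
  cutsum (fun a w => cutsum (fun b v => phi a b v) w) s.
Proof.
elim: s phi => [|x s IHs] phi; first by rewrite !cutsum0.
rewrite !cutsum_cons cutsum0 -addrA; congr (_ + _).
rewrite -IHs -cutsumD.
by apply: eq_cutsum => a c _; rewrite cutsum_cons.
Qed.

(** Isolates the letter x: it lies either in the right or in the left part of
    the cut.  This is what multilinearity in x is read off from. *)
Lemma cutsum_cat_cons phi s1 x s2 :
  cutsum phi (s1 ++ x :: s2) =
  cutsum (fun a c => phi a (c ++ x :: s2)) s1 +
  cutsum (fun a c => phi (s1 ++ x :: a) c) s2.
Proof.
elim: s1 phi => [|y s1 IHs] phi; first by rewrite cutsum_cons cutsum0.
by rewrite cat_cons !cutsum_cons IHs addrA.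
Qed.

End Deconcatenation.

(** * Sums over compositions of an integer *)

Section Compositions.
Context {V : zmodType}.
Implicit Types phi : seq nat -> V.

Lemma big_tuple_consE (I : finType) l (P : pred (seq I)) (E : seq I -> V) :
  \sum_(k : l.+1.-tuple I | P k) E k =
  \sum_(i : I) \sum_(k : l.-tuple I | P (i :: k)) E (i :: k).
Proof.
rewrite pair_big_dep /=.
rewrite (reindex (fun p : I * l.-tuple I => [tuple of p.1 :: p.2])) //=.
exists (fun k => (thead k, [tuple of behead k])) => [[i k] _|k _] /=.
  by congr pair; apply: val_inj.
by apply: val_inj; case/tupleP: k => x k.
Qed.

(** The index set of [mcomp], with the bounds M on the parts and N on the number of
    parts made independent of n, so that removing the first part of a composition
    of n yields a sum of the same form. *)
Definition compsum M N phi n : V :=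
  \sum_(l < N)
    \sum_(k : l.-tuple 'I_M | all (fun i : 'I_M => (0 < i)%N) k
                              && (sumn (map val k) == n))
      phi (map val k).

(** A composition of n is empty, with n = 0, or has a first part i + 1 <= n. *)
Lemma compsum_rec M N phi n : (n < M)%N ->
  compsum M N.+1 phi n =
  (if n == 0%N then phi [::] else 0) +
  \sum_(i < n) compsum M N (fun k => phi (i.+1%N :: k)) (n - i.+1)%N.
Proof.
move=> ltnM; rewrite /compsum big_ord_recl; congr (_ + _).
  case: eqP => [->|/eqP n0].
    rewrite (big_pred1 [tuple]) //= => k.
    by rewrite [k]tuple0 [RHS]eqxx.
  by rewrite big_pred0 // => k; rewrite tuple0 /= eq_sym (negPf n0).
transitivity (\sum_(l < N) \sum_(i < M | (0 < i <= n)%N)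
   \sum_(k : l.-tuple 'I_M | all (fun i : 'I_M => (0 < i)%N) k
                              && (sumn (map val k) == n - i)%N)
      phi (nat_of_ord i :: map val k)).
  apply: eq_bigr => l _; rewrite lift0.
  rewrite (big_tuple_consE _ (fun k => all (fun i : 'I_M => (0 < i)%N) k
     && (sumn (map val k) == n)) (fun k => phi (map val k))) [RHS]big_mkcond /=.
  apply: eq_bigr => i _; case: ifP => [/andP[i0 lein]|/negbT].
    apply: eq_bigl => k /=; rewrite i0 /=; congr (_ && _).
    by rewrite -[in RHS](eqn_add2l i) subnKC.
  rewrite negb_and => H; apply: big_pred0 => k /=.
  apply/negP => /andP[/andP[i0 _] /eqP e]; move: H.
  by rewrite i0 /= -e leq_addr.
rewrite exchange_big /=.
pose E i := \sum_(l < N) \sum_(k : l.-tuple 'I_M | all (fun i : 'I_M => (0 < i)%N) k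
  && (sumn (map val k) == n - i)%N) phi (i :: map val k).
rewrite (eq_bigr (fun i : 'I_M => E i)) //.
rewrite -[RHS]/(\sum_(i < n) E i.+1%N).
rewrite -(big_mkord (fun i => (0 < i <= n)%N) E).
rewrite (big_cat_nat (n := n.+1)) //= [X in _ + X]big1_seq ?addr0.
  rewrite big_ltn_cond //= big_add1 big_mkord.
  by apply: eq_bigl => i; rewrite ltn_ord.
move=> i /andP[/andP[_ lein]]; rewrite mem_index_iota => /andP[].
by rewrite ltnNge lein.
Qed.

Lemma compsum_bounds M M' N N' phi n : (n < M)%N -> (n < M')%N ->
  (n < N)%N -> (n < N')%N -> compsum M N phi n = compsum M' N' phi n.
Proof.
elim/ltn_ind: n N N' phi => n IHn [//|N] [//|N'] phi ltM ltM' ltN ltN'.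
rewrite !compsum_rec //; congr (_ + _); apply: eq_bigr => i _.
have ltin : (n - i.+1 < n)%N by rewrite ltn_subrL (leq_ltn_trans _ (ltn_ord i)).
by apply: IHn => //; apply: leq_trans ltin _ => //; apply: ltnW.
Qed.

End Compositions.

(** * Linearity of sums *)

Section LinearSum.
Context {K : fieldType} {U V : lmodType K}.

Lemma linear_funD (h : U -> V) : linear h -> {morph h : x y / x + y}.
Proof. by move=> lh x y; have := lh 1 x y; rewrite !scale1r. Qed.

Lemma linear_fun0 (h : U -> V) : linear h -> h 0 = 0.
Proof. by move=> /linear_funD hD; apply: (addrI (h 0)); rewrite -hD !addr0. Qed.

Lemma linear_fun_sum (h : U -> V) (I : Type) (r : seq I) (E : I -> U) :
  linear h -> h (\sum_(i <- r) E i) = \sum_(i <- r) h (E i).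
Proof. by move=> lh; apply: big_morph; [apply: linear_funD|apply: linear_fun0]. Qed.

Lemma linear_cutsum {T : Type} (h : U -> V) (phi : seq T -> seq T -> U) s :
  linear h -> h (cutsum phi s) = cutsum (fun a c => h (phi a c)) s.
Proof. exact: linear_fun_sum. Qed.

Lemma cutsum_linear {T : Type} (phi : U -> seq T -> seq T -> V) s :
  (forall a c, a ++ c = s -> linear (fun x => phi x a c)) ->
  linear (fun x => cutsum (phi x) s).
Proof.
move=> lphi k x y; rewrite /cutsum scaler_sumr -big_split.
by apply: eq_bigr => i _; rewrite lphi // cat_take_drop.
Qed.

Lemma linear_add (h h' : U -> V) :
  linear h -> linear h' -> linear (fun x => h x + h' x).
Proof. by move=> lh lh' k x y; rewrite lh lh' scalerDr addrACA. Qed.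

Lemma linear_opp (h : U -> V) : linear h -> linear (fun x => - h x).
Proof. by move=> lh k x y; rewrite lh opprD scalerN. Qed.

Lemma linear_zero : linear (fun _ : U => 0 : V).
Proof. by move=> k x y; rewrite scaler0 addr0. Qed.

End LinearSum.

(** * Product and composition of sequences of multilinear maps *)

Section MultAlgebra.
Context {K : fieldType} {B : algType K}.
Implicit Types (f g h F G X : seq B -> B) (s : seq B) (phi : B -> seq B -> B).

Definition shift (b : B) f : seq B -> B := fun s => f (b :: s).

Lemma linear_mull (U : lmodType K) (h : U -> B) b :
  linear h -> linear (fun x => b * h x).
Proof. by move=> lh k x y; rewrite lh mulrDr scalerAr. Qed.

Lemma linear_mulr (U : lmodType K) (h : U -> B) b :
  linear h -> linear (fun x => h x * b).
Proof. by move=> lh k x y; rewrite lh mulrDl scalerAl. Qed.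

Lemma linear_inv (h h' : B -> B) :
  cancel h h' -> cancel h' h -> linear h -> linear h'.
Proof. by move=> hK h'K lh k x y; rewrite -{1}[x]h'K -{1}[y]h'K -lh hK. Qed.

Lemma mmulE f g s : (f ** g) s = cutsum (fun a c => f a * g c) s.
Proof. by []. Qed.

Lemma mmul1f g : mone ** g = g.
Proof.
apply: funext => s; rewrite mmulE.
case: s => [|x s]; first by rewrite cutsum0 mul1r.
rewrite cutsum_cons mul1r /cutsum big1 ?addr0 // => i _.
by rewrite /= mul0r.
Qed.

Lemma mmulf1 f : f ** mone = f.
Proof.
apply: funext => s; rewrite mmulE.
rewrite cutsum_rcut mulr1 big1 ?add0r // => i _.
by case: drop (size_drop i s) (subn_gt0 i (size s)) => [<-|*]; rewrite ?ltn_ord ?mulr0.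
Qed.

Lemma mmulA f g h : f ** (g ** h) = f ** g ** h.
Proof.
apply: funext => s.
transitivity (cutsum (fun a w => cutsum (fun b v => f a * g b * h v) w) s).
  rewrite mmulE; apply: eq_cutsum => a w _; rewrite mmulE.
  by rewrite /cutsum mulr_sumr; apply: eq_bigr => i _; rewrite mulrA.
rewrite -cutsum_coassoc mmulE; apply: eq_cutsum => w v _.
by rewrite mmulE /cutsum mulr_suml.
Qed.

Lemma mmul_cons f g x s :
  (f ** g) (x :: s) = f [::] * g (x :: s) + (shift x f ** g) s.
Proof. exact: (cutsum_cons (fun a c => f a * g c)). Qed.

Lemma mcompE f g s : (f \oc g) s =
  compsum (size s).+1 (size s).+1 (fun k => f (map g (reshape k s))) (size s).
Proof. by []. Qed.

Lemma mcomp_nil f g : (f \oc g) [::] = f [::].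
Proof. by rewrite mcompE compsum_rec //= big_ord0 addr0. Qed.

(** Recursion on the first block x :: a of the word; only values of g at nonempty
    words occur. *)
Lemma mcomp_cons f g x s : (f \oc g) (x :: s) =
  cutsum (fun a c => (shift (g (x :: a)) f \oc g) c) s.
Proof.
rewrite mcompE compsum_rec //= add0r; apply: eq_bigr => i _.
rewrite mcompE subSS size_drop; apply: compsum_bounds => //.
all: by rewrite ltnS (leq_trans (leq_subr _ _)).
Qed.

Lemma mcomp_linear (F : B -> seq B -> B) g s :
  (forall t, linear (F^~ t)) -> linear (fun b => (F b \oc g) s).
Proof.
move=> lF k x y; rewrite /mcomp scaler_sumr -big_split; apply: eq_bigr => l _.
by rewrite scaler_sumr -big_split; apply: eq_bigr => t _; rewrite lF.
Qed.

Lemma mcompD f f' g s :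
  ((fun t => f t + f' t) \oc g) s = (f \oc g) s + (f' \oc g) s.
Proof.
rewrite /mcomp -big_split; apply: eq_bigr => l _; exact: big_split.
Qed.

Lemma mcomp0 g s : ((fun=> 0) \oc g) s = 0.
Proof. by rewrite /mcomp big1 // => l _; rewrite big1. Qed.

(** A convolution whose second factor may depend on the value of the first. It
    covers the product (phi b t = b * g t) and, by [shift_mcomp], the composite with
    its first letter frozen, so that distributivity and associativity are
    instances of the single lemma [mcomp_conv]. *)
Definition conv g phi : seq B -> B := fun s => cutsum (fun a c => phi (g a) c) s.

Lemma shift_conv b g phi :
  shift b (conv g phi) = fun s => shift b (phi (g [::])) s + conv (shift b g) phi s.
Proof. by apply: funext => s; rewrite /shift /conv cutsum_cons. Qed.

Lemma shift_mcomp b f g :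
  shift b (f \oc g) = conv (shift b g) (fun c => shift c f \oc g).
Proof. by apply: funext => s; rewrite /shift mcomp_cons. Qed.

(** Right distributivity of composition.  Both sides split off the first block of s
    under h: it starts either the word seen by phi, when g eats no letter, or the
    word seen by g; the second case is coassociativity and the induction
    hypothesis. *)
Lemma mcomp_conv g phi h s : (forall t, linear (phi^~ t)) ->
  (conv g phi \oc h) s = conv (g \oc h) (fun b => phi b \oc h) s.
Proof.
move=> lphi; have [n] := ubnP (size s); elim: n s g => // n IHn [|x s] g.
  by rewrite mcomp_nil /conv !cutsum0 !mcomp_nil.
rewrite ltnS /= => ltsn; rewrite mcomp_cons [RHS]cutsum_cons mcomp_nil mcomp_cons.
rewrite (eq_cutsum (psi := fun a c =>
   (shift (h (x :: a)) (phi (g [::])) \oc h) c +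
   conv (shift (h (x :: a)) g \oc h) (fun b => phi b \oc h) c)); last first.
  move=> a c acs; rewrite shift_conv mcompD IHn //.
  by apply: leq_ltn_trans ltsn; rewrite -acs size_cat leq_addl.
rewrite cutsumD; congr (_ + _); rewrite /conv -[LHS]cutsum_coassoc.
apply: eq_cutsum => w v _; rewrite mcomp_cons.
by rewrite (linear_cutsum (h := fun b => (phi b \oc h) v)) //; apply: mcomp_linear.
Qed.

Lemma mcomp_mull f g h : (f ** g) \oc h = (f \oc h) ** (g \oc h).
Proof.
apply: funext => s; rewrite -[f ** g]/(conv f (fun b t => b * g t)).
rewrite mcomp_conv; last by move=> t; apply: linear_mulr => k x y.
rewrite mmulE; apply: eq_cutsum => a c _.
rewrite /mcomp mulr_sumr; apply: eq_bigr => l _.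
by rewrite mulr_sumr.
Qed.

Lemma multilinear_head f t : multilinear f -> linear (fun b => shift b f t).
Proof. by move=> mf; apply: (mf [::]). Qed.

Lemma multilinear_shift f b : multilinear f -> multilinear (shift b f).
Proof. by move=> mf s1 s2; apply: (mf (b :: s1)). Qed.

(** Freezing the first block of s turns f o g into the convolution of a shift of g
    with the maps [shift c f] o g; [mcomp_conv] distributes h over it, and the
    induction hypothesis applies to the multilinear maps [shift c f].
    Multilinearity of f is what lets a sum of values of g inside f come out. *)
Lemma mcompA f g h : multilinear f -> (f \oc g) \oc h = f \oc (g \oc h).
Proof.
move=> mf; apply: funext => s; have [n] := ubnP (size s).
elim: n s f mf => // n IHn [|x s] f mf; first by rewrite !mcomp_nil.
rewrite ltnS /= => ltsn; rewrite !mcomp_cons.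
rewrite (eq_cutsum (psi := fun a w => cutsum (fun u v =>
   (shift ((shift (h (x :: a)) g \oc h) u) f \oc (g \oc h)) v) w)).
  rewrite -cutsum_coassoc; apply: eq_cutsum => w v wvs; rewrite mcomp_cons.
  rewrite (linear_cutsum (h := fun c => (shift c f \oc (g \oc h)) v)) //.
  by apply: mcomp_linear => t; apply: multilinear_head.
move=> a w aws; rewrite shift_mcomp mcomp_conv; last first.
  by move=> t; apply: mcomp_linear => t'; apply: multilinear_head.
apply: eq_cutsum => u v uvw; apply: IHn; first exact: multilinear_shift.
apply: leq_ltn_trans ltsn.
by rewrite -aws -uvw !size_cat addnA leq_addl.
Qed.

Lemma mcomp1f g : mone \oc g = mone.
Proof.
apply: funext => -[|x s]; first by rewrite mcomp_nil.
by rewrite mcomp_cons /cutsum big1 // => i _; apply: mcomp0.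
Qed.

Lemma mcompIf g : g [::] = 0 -> mid \oc g = g.
Proof.
move=> g0; apply: funext => -[|x s]; first by rewrite mcomp_nil g0.
rewrite mcomp_cons cutsum_rcut mcomp_nil big1 ?add0r // => i _.
case: drop (size_drop i s) (subn_gt0 i (size s)) => [<-|y t _ _].
  by rewrite ltn_ord.
by rewrite mcomp_cons /cutsum big1 // => j _; apply: mcomp0.
Qed.

Lemma mcompfI f : multilinear f -> f \oc mid = f.
Proof.
move=> mf; apply: funext => s; elim: s f mf => [|x s IHs] f mf.
  by rewrite mcomp_nil.
have shift0 : shift 0 f = fun=> 0.
  by apply: funext => t; apply: (linear_fun0 (multilinear_head t mf)).
rewrite mcomp_cons /cutsum big_ord_recl take0 drop0 IHs; last first.
  exact: multilinear_shift.
rewrite big1 ?addr0 // => i _; rewrite lift0.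
by case: s {IHs} i => [[]|y s i] //=; rewrite shift0 mcomp0.
Qed.

Lemma multilinear_mmul f g : multilinear f -> multilinear g -> multilinear (f ** g).
Proof.
move=> mf mg s1 s2; rewrite (_ : (fun x => _) = fun x =>
   cutsum (fun a c => f a * g (c ++ x :: s2)) s1 +
   cutsum (fun a c => f (s1 ++ x :: a) * g c) s2); last first.
  by apply: funext => x; rewrite mmulE cutsum_cat_cons.
apply: linear_add; apply: cutsum_linear => a c _.
  exact: linear_mull.
exact: linear_mulr.
Qed.

(** By [mcomp_cons], the letter x lies in the first block, where linearity of g and
    of f in its first argument applies, or after it, where the induction
    hypothesis on the word s1 before x does. *)
Lemma multilinear_mcomp f g : multilinear f -> multilinear g -> multilinear (f \oc g).
Proof.
move=> mf mg s1; have [n] := ubnP (size s1).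
elim: n s1 f mf => // n IHn s1 f mf lt_s1 s2.
have lin_head (r : seq B) : linear (fun b => (shift b f \oc g) r).
  by apply: mcomp_linear => t; apply: multilinear_head.
have lin_block r1 r2 r : linear (fun x => (shift (g (r1 ++ x :: r2)) f \oc g) r).
  by move=> k x y; rewrite (mg r1 r2) lin_head.
case: s1 lt_s1 => [|b s1] lt_s1.
  rewrite (_ : (fun x => _) = fun x =>
    cutsum (fun a c => (shift (g (x :: a)) f \oc g) c) s2); last first.
    by apply: funext => x; rewrite mcomp_cons.
  by apply: cutsum_linear => a c _; apply: (lin_block [::]).
rewrite (_ : (fun x => _) = fun x =>
   cutsum (fun a c => (shift (g (b :: a)) f \oc g) (c ++ x :: s2)) s1 +
   cutsum (fun a c => (shift (g (b :: s1 ++ x :: a)) f \oc g) c) s2); last first.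
  by apply: funext => x; rewrite mcomp_cons cutsum_cat_cons.
apply: linear_add; apply: cutsum_linear => a c acs.
  apply: IHn; first exact: multilinear_shift.
  by apply: leq_ltn_trans (lt_s1 : size s1 < n)%N; rewrite -acs size_cat leq_addl.
exact: (lin_block (b :: s1)).
Qed.

Lemma multilinear_mone : multilinear (mone : seq B -> B).
Proof. by case=> [|? ?] s2; apply: linear_zero. Qed.

Lemma multilinear_mid : multilinear (mid : seq B -> B).
Proof.
case=> [|? [|? ?]] [|? ?]; try exact: linear_zero.
by move=> k x y.
Qed.

(** * The groups of invertible sequences *)

Definition agree n g g' := forall s, (size s <= n)%N -> g s = g' s.

(** Each iteration fixes one more degree, so the iterates stabilize degreewise to a
    fixed point.  In each degree the fixed point is a single iterate, which
    is why it inherits multilinearity. *)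
Lemma iter_limit (P : (seq B -> B) -> (seq B -> B)) z :
    (forall n g g', agree n g g' -> agree n.+1 (P g) (P g')) ->
    P z [::] = z [::] -> multilinear z ->
    (forall g, multilinear g -> multilinear (P g)) ->
  exists g, [/\ multilinear g, g [::] = z [::] & P g = g].
Proof.
move=> Pagree Pz0 mz mP; pose g s := iter (size s) P z s.
have agree_step n : agree n (iter n P z) (iter n.+1 P z).
  elim: n => [|n IHn]; last by rewrite iterS; apply: Pagree.
  by case=> //= _; rewrite Pz0.
have agree_iter n : agree n g (iter n P z).
  move=> s /subnKC <-; elim: (n - size s)%N => [|m IHm].
    by rewrite addn0.
  by rewrite IHm addnS agree_step // leq_addr.
exists g; split=> //; last first.
  apply: funext => s; rewrite [RHS]agree_step // iterS.
  exact: Pagree (agree_iter _) _ _.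
have miter n : multilinear (iter n P z) by elim: n => //= n; apply: mP.
move=> s1 s2 k x y; rewrite /g !size_cat /=; exact: miter.
Qed.

Lemma mcomp_agree n f g g' s : agree n g g' -> (size s <= n)%N ->
  (f \oc g) s = (f \oc g') s.
Proof.
move=> gg'; have [m] := ubnP (size s).
elim: m s f => // m IHm [|x s] f; first by rewrite !mcomp_nil.
rewrite ltnS /= => ltsm ltsn; rewrite !mcomp_cons; apply: eq_cutsum => a c acs.
move: ltsm ltsn; rewrite -acs size_cat => ltsm ltsn.
rewrite gg' /=; last by apply: leq_trans ltsn; rewrite ltnS leq_addr.
apply: IHm; first by apply: leq_ltn_trans ltsm; apply: leq_addl.
by apply: leq_trans (ltnW ltsn); apply: leq_addl.
Qed.

(** The fixed points of g + b (1 - f g) are the right inverses of f; since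
    b f_0 = 1, the top-degree term of g cancels, so that the iteration is
    contracting. *)
Lemma mmul_rinv f b : multilinear f -> b * f [::] = 1 -> f [::] * b = 1 ->
  exists g, [/\ multilinear g, g [::] = b & f ** g = mone].
Proof.
move=> mf bf fb.
pose P g := fun s => g s + b * (mone s - (f ** g) s).
have [||||g [mg g0 Pg]] := @iter_limit P (fun s => b * mone s).
- move=> n g g' gg' [|x s] les; rewrite /P.
    by rewrite /mmul !big_ord1 !gg'.
  have cancel_head h : h (x :: s) + b * (mone (x :: s) - (f ** h) (x :: s)) =
      - (b * (shift x f ** h) s).
    by rewrite mmul_cons sub0r mulrN mulrDr mulrA bf mul1r opprD addrA subrr sub0r.
  rewrite !cancel_head !mmulE; congr (- (_ * _)); apply: eq_cutsum => a c acs.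
  by rewrite gg' // (leq_trans _ (les : size s <= n)%N) // -acs size_cat leq_addl.
- by rewrite /P /mmul big_ord1 !mulr1 fb subrr mulr0 addr0.
- by move=> s1 s2; apply: linear_mull; apply: multilinear_mone.
- move=> g mg s1 s2; apply: linear_add; first exact: mg.
  apply: linear_mull; apply: linear_add; first exact: multilinear_mone.
  by apply: linear_opp; apply: multilinear_mmul.
have fg : f ** g = mone.
  apply: funext => s; have /eqP := congr1 (@^~ s) Pg.
  rewrite /P -subr_eq0 addrAC subrr add0r => /eqP e.
  by apply/esym/subr0_eq; rewrite -[LHS]mul1r -fb -mulrA e mulr0.
by exists g; split=> //; rewrite g0 mulr1.
Qed.

(** As for the product: since f_1 is bijective, g + f_1^{-1} (I - f o g) depends in
    each degree only on the lower degrees of g. *)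
Lemma mcomp_rinv f : Gdif f -> exists2 g, Gdif g & f \oc g = mid.
Proof.
case=> mf f0 bij_f; have [fi fK fiK] := bij_f.
have lf : linear (fun x => f [:: x]) by apply: (mf [::] [::]).
have lfi : linear fi by apply: linear_inv fK fiK lf.
pose P g := fun s => g s + fi (mid s - (f \oc g) s).
have [||||g [mg g0 Pg]] := @iter_limit P (fun=> 0).
- move=> n g g' gg' [|x s] les; rewrite /P.
    by rewrite !mcomp_nil !gg'.
  rewrite !mcomp_cons !cutsum_rcut !mcomp_nil !opprD !addrA.
  rewrite !(linear_funD lfi) !(addrC (g _)) !(addrC (g' _)) -!addrA.
  have fiN u : fi (- f [:: u]) + u = 0.
    by rewrite -{2}[u]fK -(linear_funD lfi) addNr (linear_fun0 lfi).
  rewrite !fiN; congr (_ + (_ + _)); congr (fi (- _)).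
  apply: eq_bigr => i _.
  rewrite gg'; last first.
    by rewrite /= size_takel ?(leq_trans (ltn_ord i) les) // ltnW.
  apply: mcomp_agree gg' _; rewrite size_drop.
  exact: leq_trans (leq_subr _ _) _.
- by rewrite /P mcomp_nil f0 subrr (linear_fun0 lfi) addr0.
- by move=> s1 s2; apply: linear_zero.
- move=> g mg s1 s2; apply: linear_add; first exact: mg.
  move=> k x y; rewrite -lfi; congr fi; move: k x y.
  apply: linear_add; first exact: multilinear_mid.
  by apply: linear_opp; apply: multilinear_mcomp.
have fg : f \oc g = mid.
  apply: funext => s; have /eqP := congr1 (@^~ s) Pg.
  rewrite /P -subr_eq0 addrAC subrr add0r => /eqP e.
  by apply/esym/subr0_eq; rewrite -[LHS]fiK e (linear_fun0 lf).
have f1g1 x : f [:: g [:: x]] = x.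
  by have := congr1 (@^~ [:: x]) fg; rewrite mcomp_cons cutsum0 mcomp_nil.
exists g => //; split=> //; exists (fun x => f [:: x]) => x //=.
by apply: (can_inj fK); rewrite /= f1g1.
Qed.

(** A right inverse is again invertible, so it has a right inverse too, and
    associativity makes inverses two-sided; the same holds for [mcinvP]. *)
Lemma minvP F : Ginv F ->
  [/\ Ginv (minv F), F ** minv F = mone & minv F ** F = mone].
Proof.
move=> [mF [b [bF Fb]]]; have [g [mg g0 Fg]] := mmul_rinv mF bF Fb.
have [|| h [_ _ gh]] := mmul_rinv (b := F [::]) mg; rewrite ?g0 //.
have gF : g ** F = mone.
  by have <- : h = F by rewrite -[h]mmul1f -Fg -mmulA gh mmulf1.
apply: (@xgetPex _ mone [set g' : seq B -> B | [/\ Ginv g', F ** g' = mone & g' ** F = mone]]%classic).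
by exists g; split=> //; split=> //; exists (F [::]); rewrite g0.
Qed.

Lemma mcinvP f : Gdif f ->
  [/\ Gdif (mcinv f), f \oc mcinv f = mid & mcinv f \oc f = mid].
Proof.
move=> df; have [g dg fg] := mcomp_rinv df; have [h dh gh] := mcomp_rinv dg.
have [mf f0 _] := df; have [mg _ _] := dg; have [_ h0 _] := dh.
have fh : f = h by rewrite -[f]mcompfI // -gh -mcompA // fg mcompIf.
apply: (@xgetPex _ mid [set g' : seq B -> B | [/\ Gdif g', f \oc g' = mid & g' \oc f = mid]]%classic).
by exists g; split=> //; rewrite fh.
Qed.

Lemma mcinv_unique f g : Gdif f -> g [::] = 0 -> f \oc g = mid -> mcinv f = g.
Proof.
move=> df g0 fg; have [[mc _ _] _ cf] := mcinvP df.
by rewrite -(mcompfI mc) -fg -mcompA // cf mcompIf.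
Qed.

Lemma mmul_lcancel F f g : Ginv F -> F ** f = F ** g -> f = g.
Proof.
by move=> /minvP[_ _ VF] e; rewrite -[f]mmul1f -[g]mmul1f -VF -!mmulA e.
Qed.

Lemma mmul_rcancel F f g : Ginv F -> f ** F = g ** F -> f = g.
Proof.
by move=> /minvP[_ FV _] e; rewrite -[f]mmulf1 -[g]mmulf1 -FV !mmulA e.
Qed.

Lemma mid_mmulE f x s : (mid ** f) (x :: s) = x * f s.
Proof.
rewrite mmul_cons mul0r add0r mmulE.
case: s => [|y s]; first by rewrite cutsum0.
by rewrite cutsum_cons /cutsum big1 ?addr0 // => i _; rewrite [shift _ _ _]/= mul0r.
Qed.

(** Only the cut before the last letter contributes. *)
Lemma mmul_midE f s x : (f ** mid) (rcons s x) = f s * x.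
Proof.
rewrite mmulE -cats1 cutsum_cat_cons cutsum0 mulr0 addr0 cutsum_rcut.
rewrite big1 ?add0r // => i _.
case: drop (size_drop i s) (subn_gt0 i (size s)) => [<-|y [|z t] _ _] /=.
- by rewrite ltn_ord.
- by rewrite mulr0.
- by rewrite mulr0.
Qed.

Lemma mmul_mid_inj f g : f ** mid = g ** mid -> f = g.
Proof.
move=> e; apply: funext => s; have := congr1 (@^~ (rcons s 1)) e.
by rewrite !mmul_midE !mulr1.
Qed.

Lemma mid_mmul_inj f g : mid ** f = mid ** g -> f = g.
Proof.
move=> e; apply: funext => s; have := congr1 (@^~ (1 :: s)) e.
by rewrite !mid_mmulE !mul1r.
Qed.

Lemma Ginv_mmul F G : Ginv F -> Ginv G -> Ginv (F ** G).
Proof.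
move=> [mF [b [bF Fb]]] [mG [c [cG Gc]]]; split; first exact: multilinear_mmul.
exists (c * b); rewrite mmulE cutsum0; split.
  by rewrite -mulrA [b * _]mulrA bF mul1r.
by rewrite -mulrA [G _ * _]mulrA Gc mul1r.
Qed.

Lemma Ginv_mcomp F g : Ginv F -> multilinear g -> Ginv (F \oc g).
Proof. by case=> mF uF mg; split; [apply: multilinear_mcomp|rewrite mcomp_nil]. Qed.

Lemma Gdif_mid_mmul F : Ginv F -> Gdif (mid ** F).
Proof.
move=> [mF [b [bF Fb]]]; split.
- exact: multilinear_mmul multilinear_mid mF.
- by rewrite mmulE cutsum0 mul0r.
by exists (fun y => y * b) => x; rewrite mid_mmulE -mulrA ?bF ?Fb mulr1.
Qed.

Lemma Gdif_mmul_mid F : Ginv F -> Gdif (F ** mid).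
Proof.
move=> [mF [b [bF Fb]]]; split.
- exact: multilinear_mmul mF multilinear_mid.
- by rewrite mmulE cutsum0 mulr0.
by exists (fun y => b * y) => x; rewrite (mmul_midE F [::]) mulrA ?bF ?Fb mul1r.
Qed.

(** * The maps S^l and S^r *)

(** With c the inverse of I F: I = (I F) o c = c (F o c), hence
    I (F^{-1} o c) = c (F o c) (F^{-1} o c) = c. *)
Lemma mid_S_l F : Ginv F -> mid ** S_l F = mcinv (mid ** F).
Proof.
move=> uF; have [[_ c0 _] Fc _] := mcinvP (Gdif_mid_mmul uF).
have [_ FV _] := minvP uF; rewrite /S_l; set c := mcinv _ in c0 Fc *.
rewrite -{1}Fc mcomp_mull mcompIf // -mmulA -mcomp_mull FV mcomp1f.
exact: mmulf1.
Qed.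

Lemma S_r_mid F : Ginv F -> S_r F ** mid = mcinv (F ** mid).
Proof.
move=> uF; have [[_ c0 _] Fc _] := mcinvP (Gdif_mmul_mid uF).
have [_ _ VF] := minvP uF; rewrite /S_r; set c := mcinv _ in c0 Fc *.
rewrite -{1}Fc mcomp_mull mcompIf // mmulA -mcomp_mull VF mcomp1f.
exact: mmul1f.
Qed.

Lemma Ginv_S_l F : Ginv F -> Ginv (S_l F).
Proof.
move=> uF; have [[mc _ _] _ _] := mcinvP (Gdif_mid_mmul uF).
by apply: Ginv_mcomp mc; case: (minvP uF).
Qed.

Lemma Ginv_S_r F : Ginv F -> Ginv (S_r F).
Proof.
move=> uF; have [[mc _ _] _ _] := mcinvP (Gdif_mmul_mid uF).
by apply: Ginv_mcomp mc; case: (minvP uF).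
Qed.

Lemma S_l_unique F X : Ginv F -> (mid ** F) \oc (mid ** X) = mid -> S_l F = X.
Proof.
move=> uF e; apply: mid_mmul_inj; rewrite mid_S_l //.
by apply: mcinv_unique e; [apply: Gdif_mid_mmul|rewrite mmulE cutsum0 mul0r].
Qed.

Lemma S_r_unique F X : Ginv F -> (F ** mid) \oc (X ** mid) = mid -> S_r F = X.
Proof.
move=> uF e; apply: mmul_mid_inj; rewrite S_r_mid //.
by apply: mcinv_unique e; [apply: Gdif_mmul_mid|rewrite mmulE cutsum0 mulr0].
Qed.

Lemma mid_S_lK F : Ginv F ->
  (mid ** F) \oc (mid ** S_l F) = mid /\ (mid ** S_l F) \oc (mid ** F) = mid.
Proof. by move=> uF; rewrite mid_S_l //; case: (mcinvP (Gdif_mid_mmul uF)). Qed.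

Lemma S_r_midK F : Ginv F ->
  (F ** mid) \oc (S_r F ** mid) = mid /\ (S_r F ** mid) \oc (F ** mid) = mid.
Proof. by move=> uF; rewrite S_r_mid //; case: (mcinvP (Gdif_mmul_mid uF)). Qed.

Lemma S_l_mcomp F : Ginv F -> S_l F \oc (mid ** F) = minv F.
Proof.
move=> uF; have [[mV _] _ _] := minvP uF.
have [_ _ cF] := mcinvP (Gdif_mid_mmul uF).
by rewrite /S_l mcompA // cF mcompfI.
Qed.

(** * The factorization of the boxed convolution *)

Section Factorization.
Context (F G : seq B -> B) (hF : Ginv F) (hG : Ginv G).

Let H1 := S_l (rhd_r G (S_l F)).
Let H2 := S_r (rhd_l F (S_r G)).
(** Shown to equal H2 in [H2_rhd_l]; defined from H1 alone, it gives the exchange identity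
    before H2 enters. *)
Let Y := rhd_l H1 G.

Let mid_nil X : (mid ** X) [::] = 0 :> B.
Proof. by rewrite mmulE cutsum0 mul0r. Qed.
Let nil_mid X : (X ** mid) [::] = 0 :> B.
Proof. by rewrite mmulE cutsum0 mulr0. Qed.
Let mmid X : Ginv X -> multilinear (X ** mid).
Proof. by case/Gdif_mmul_mid. Qed.
Let midm X : Ginv X -> multilinear (mid ** X).
Proof. by case/Gdif_mid_mmul. Qed.

Let hAG : Ginv (rhd_r G (S_l F)).
Proof. by apply: Ginv_mcomp; [apply: Ginv_S_l|apply: mmid]. Qed.
Let hCF : Ginv (rhd_l F (S_r G)).
Proof. by apply: Ginv_mcomp; [apply: Ginv_S_r|apply: midm]. Qed.
Let hH1 : Ginv H1. Proof. exact: Ginv_S_l. Qed.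
Let hY : Ginv Y. Proof. by apply: Ginv_mcomp => //; apply: midm. Qed.

(** By distributivity the left side is (G o (I H1)) times
    (I (S^l(F) o (G I))) o (I H1), and the second factor is I by definition of H1. *)
Lemma S_l_transport :
  ((mid ** S_l F) \oc (G ** mid)) \oc (mid ** H1) = Y ** mid.
Proof.
rewrite mcomp_mull mcompIf // -mmulA mcomp_mull.
by have [-> _] := mid_S_lK hAG.
Qed.

Lemma exchange : (G ** mid) \oc (mid ** H1) = (mid ** F) \oc (Y ** mid).
Proof.
rewrite -S_l_transport -!mcompA; try exact: midm; try exact/midm/Ginv_S_l.
by have [-> _] := mid_S_lK hF; rewrite mcompIf.
Qed.

Lemma H1_rhd_r : H1 = F \oc (Y ** mid).
Proof.
have := exchange; rewrite !mcomp_mull !mcompIf // -!mmulA.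
by move/(mmul_lcancel hY)/mid_mmul_inj.
Qed.

Lemma H2_rhd_l : H2 = Y.
Proof.
apply: S_r_unique => //; apply: (mmul_rcancel hH1).
(* Multiplying by H1 = F o (Y I) completes the left side to
   ((S_r G I) o (I F)) o (Y I), to which the exchange identity applies. *)
rewrite {1}H1_rhd_r -mcomp_mull -mmulA -{1}[mid ** F](mcompIf (mid_nil F)) -mcomp_mull.
rewrite mcompA; last exact/mmid/Ginv_S_r.
rewrite -exchange -mcompA; last exact/mmid/Ginv_S_r.
by have [_ ->] := S_r_midK hG; rewrite mcompIf.
Qed.

(** Both I (H1 Y) and the inverse of I (A . D), for A = S^l(F) and D = S^l(G), are
    (I G) o (I H1). *)
Lemma boxconv_mmul : boxconv F G = H1 ** Y.
Proof.
have hA := Ginv_S_l hF; have hD := Ginv_S_l hG.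
have [hVD _ VDD] := minvP hD; have [hVG GVG _] := minvP hG.
have mX : multilinear (minv (S_l G) ** mid ** S_l G).
  by apply: multilinear_mmul; [apply: mmid|case: hD].
have hAD : Ginv (bullet (S_l F) (S_l G)).
  by apply: Ginv_mmul => //; apply: Ginv_mcomp.
apply: S_l_unique => //.
have -> : mid ** (H1 ** Y) = (mid ** G) \oc (mid ** H1).
  by rewrite [RHS]mcomp_mull mcompIf // mmulA.
rewrite -mcompA; last exact: midm.
have VD_G : minv (S_l G) \oc (mid ** G) = G.
  apply: (mmul_rcancel hVG).
  by rewrite GVG -(S_l_mcomp hG) -mcomp_mull VDD mcomp1f.
have [_ DG] := mid_S_lK hG.
(* D o (I G) = G^{-1} turns D^{-1} I D, composed with I G, into G I. *)
rewrite /bullet mmulA mcomp_mull DG mcompA; last by case: hA.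
rewrite -mmulA [X in S_l F \oc X]mcomp_mull VD_G DG.
by have [-> _] := mid_S_lK hAG.
Qed.

End Factorization.

End MultAlgebra.

Theorem lemma3p31 (K : fieldType) (charK0 : [pchar K] =i pred0)
    (B : algType K) (F G : seq B -> B) (hF : Ginv F) (hG : Ginv G) :
  let H1 := S_l (rhd_r G (S_l F)) in
  let H2 := S_r (rhd_l F (S_r G)) in
  [/\ boxconv F G = star_l G H1,
      boxconv F G = star_r F H2 &
      boxconv F G = H1 ** H2] /\
  [/\ H1 = rhd_r H2 F & H2 = rhd_l H1 G] /\
  [/\ (G ** mid) \oc (mid ** H1) = (mid ** F) \oc (H2 ** mid) &
      forall L : seq B -> B, Ginv L ->
        rhd_l H1 (rhd_r G L) = rhd_r H2 (rhd_l F L)].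
Proof.
move=> H1 H2.
have e2 : H2 = rhd_l H1 G by apply: H2_rhd_l.
have e1 : H1 = rhd_r H2 F by rewrite e2; apply: H1_rhd_r.
have box : boxconv F G = H1 ** H2 by rewrite e2; apply: boxconv_mmul.
have ex : (G ** mid) \oc (mid ** H1) = (mid ** F) \oc (H2 ** mid).
  by rewrite e2; apply: exchange.
split; [split=> // | split; [by split | split=> //]].
- by rewrite box e2.
- by rewrite box {1}e1.
- by move=> L [mL _]; rewrite /rhd_l /rhd_r !mcompA // ex.
Qed.
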